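(* For all integers $n\ge 1$ and $k\ge 1$ and all $x\in\mathbb{C}$, $$(-1)^n\frac{\widehat{C}_n^{(k)}(x)}{n!}=\sum_{m=1}^{n}\binom{n-1}{n-m}\frac{C_m^{(k)}(x)}{m!}.$$
   Context: $(x)_n = x(x-1)\cdots(x-n+1)$ denotes the falling factorial, with $(x)_0=1$. For integers $k\ge1$, $n\ge0$, the higher-order Cauchy polynomials (of order $k$) of the first and second kind are, respectively, $$C_n^{(k)}(x)=\int_0^1\cdots\int_0^1 (x_1+\cdots+x_k-x)_n\,dx_1\cdots dx_k,$$ $$\widehat{C}_n^{(k)}(x)=\int_0^1\cdots\int_0^1 (x-(x_1+\cdots+x_k))_n\,dx_1\cdots dx_k.$$ *)

(* Defs.v *)
From Stdlib Require Import Reals.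
From Stdlib Require Vector.
From Coquelicot Require Import Coquelicot.

(* z (z - 1) ... (z - n + 1) *)
Fixpoint falling (z : C) (n : nat) : C :=
  match n with
  | O => RtoC 1
  | S n' => (falling z n' * (z - RtoC (INR n')))%C
  end.

(* Iterated Riemann integral of f over [0,1]^k, C being viewed as a complete
   normed space over R.  The last coordinate is the outermost variable, as in
   int_0^1 ... int_0^1 f(x_1, ..., x_k) dx_1 ... dx_k. *)
Fixpoint cube_RInt (k : nat) : (Vector.t R k -> C) -> C :=
  match k return (Vector.t R k -> C) -> C with
  | O => fun f => f (Vector.nil R)
  | S k' => fun f =>
      @RInt C_R_CompleteNormedModule
        (fun t : R => cube_RInt k' (fun v => f (Vector.shiftin t v))) 0 1
  end.

Definition coord_sum (k : nat) (v : Vector.t R k) : R :=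
  Vector.fold_right Rplus v 0%R.

Definition cauchy1 (k n : nat) (x : C) : C :=
  cube_RInt k (fun v => falling (RtoC (coord_sum k v) - x)%C n).

Definition cauchy2 (k n : nat) (x : C) : C :=
  cube_RInt k (fun v => falling (x - RtoC (coord_sum k v))%C n).

(* Main.v *)
Require Import Defs.
From Stdlib Require Import Reals Factorial Lra Lia.
From Stdlib Require Vector.
From Coquelicot Require Import Coquelicot.

(** Once the integral signs are removed the statement is an identity between
    polynomials in one variable [z = x_1 + ... + x_k - x].  Reversing the
    order of the factors turns [(-1)^n (-z)_n] into the rising product
    [z (z+1) ... (z+n-1) = (z+n-1)_n] ([falling_opp]), so with generalized
    binomial coefficients [binom(z,m) = (z)_m / m!] the claim reads
    [binom(z+n-1, n) = sum_(m=1..n) binom(n-1, n-m) binom(z,m)].  This is the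
    Vandermonde convolution of [z] with the natural number [n-1]; its term
    [m = 0] vanishes because [n > n-1].  As one argument is a natural number,
    it follows from iterating Pascal's rule [n-1] times
    ([gbinom_vandermonde]).

    The identity is then integrated over the cube, which requires linearity
    of the iterated integral.  Riemann integrals are additive only on integrable
    functions, so each inner integral must be shown to depend continuously on
    the outer variables.  All integrands here are continuous functions of the
    coordinate sum, and integrating out one coordinate replaces [g] by the
    moving average [t |-> int_t^(t+1) g], which is continuous again
    ([continuous_cube_RInt_shift]). *)

(** * Falling factorials and Vandermonde's convolution *)

Lemma falling_shift (z : C) (n : nat) :
  falling (z + 1)%C (S n) = ((z + 1) * falling z n)%C.
Proof.
  induction n as [|n IHn]; [simpl; ring|].
  change (falling (z + 1)%C (S (S n)))
    with (falling (z + 1)%C (S n) * (z + 1 - RtoC (INR (S n))))%C.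
  rewrite IHn, S_INR, RtoC_plus; simpl; ring.
Qed.

Lemma falling_opp (z : C) (n : nat) :
  (RtoC ((-1) ^ S n)%R * falling (- z)%C (S n))%C =
  falling (z + RtoC (INR n))%C (S n).
Proof.
  induction n as [|n IHn].
  { simpl; rewrite Rmult_1_r; change (-1)%R with (- (1))%R;
    rewrite RtoC_opp; ring. }
  replace (z + RtoC (INR (S n)))%C with (z + RtoC (INR n) + 1)%C
    by (rewrite S_INR, RtoC_plus; ring).
  rewrite falling_shift, <- IHn.
  change (falling (- z)%C (S (S n)))
    with (falling (- z)%C (S n) * (- z - RtoC (INR (S n))))%C.
  rewrite <- tech_pow_Rmult.
  rewrite S_INR, RtoC_mult, RtoC_plus; change (-1)%R with (- (1))%R.
  rewrite RtoC_opp; ring.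
Qed.

Definition gbinom (z : C) (m : nat) : C :=
  (falling z m / RtoC (INR (fact m)))%C.

Lemma RtoC_INR_neq_0 (n : nat) : n <> 0%nat -> RtoC (INR n) <> RtoC 0.
Proof. intros Hn H; apply RtoC_inj in H; now apply (not_0_INR n). Qed.

Lemma gbinom_pascal (z : C) (m : nat) :
  gbinom (z + 1)%C (S m) = (gbinom z (S m) + gbinom z m)%C.
Proof.
  unfold gbinom.
  rewrite falling_shift, fact_simpl, mult_INR, RtoC_mult.
  pose proof (RtoC_INR_neq_0 (S m) ltac:(discriminate)) as HS.
  pose proof (RtoC_INR_neq_0 (fact m) (fact_neq_0 m)) as Hf.
  simpl falling; rewrite S_INR, RtoC_plus in *.
  now field.
Qed.

(** Summation by parts for Pascal's triangle, stated for partial sums: the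
    correction term telescopes, and at [m = j] it is exactly the last entry
    of row [j + 1]. *)
Lemma sum_pascal_partial (a : nat -> C) (j m : nat) : (m <= j)%nat ->
  (sum_n (fun i => RtoC (Binomial.C (S j) i) * a i) m
    + RtoC (Binomial.C j m) * a (S m))%C =
  sum_n (fun i => RtoC (Binomial.C j i) * (a (S i) + a i))%C m.
Proof.
  induction m as [|m IHm]; intros Hm.
  { rewrite !sum_O, !C_n_0; ring. }
  rewrite !sum_Sn, <- IHm by lia.
  rewrite <- (pascal j m), RtoC_plus by lia.
  change plus with Cplus; ring.
Qed.

Lemma sum_pascal (a : nat -> C) (j : nat) :
  sum_n (fun i => RtoC (Binomial.C (S j) i) * a i)%C (S j) =
  sum_n (fun i => RtoC (Binomial.C j i) * (a (S i) + a i))%C j.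
Proof.
  rewrite <- (sum_pascal_partial a j j (le_n j)), sum_Sn, !C_n_n.
  reflexivity.
Qed.

(** Keeping the lower index at least [j] lets Pascal's rule be applied [j]
    times without ever reaching a negative index. *)
Lemma gbinom_vandermonde (z : C) (j p : nat) :
  gbinom (z + RtoC (INR j))%C (p + j) =
  sum_n (fun i => RtoC (Binomial.C j i) * gbinom z (p + i))%C j.
Proof.
  revert p; induction j as [|j IHj]; intros p.
  { rewrite sum_O, C_n_0; simpl; rewrite Cplus_0_r; ring. }
  replace (z + RtoC (INR (S j)))%C with (z + RtoC (INR j) + 1)%C
    by (rewrite S_INR, RtoC_plus; ring).
  rewrite Nat.add_succ_r, gbinom_pascal.
  rewrite sum_pascal with (a := fun i => gbinom z (p + i)).
  change (S (p + j)) with (S p + j)%nat.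
  rewrite !IHj, <- (sum_n_plus (G := C_AbelianMonoid)).
  apply sum_n_ext; intros i.
  rewrite Nat.add_succ_r; change plus with Cplus; simpl; ring.
Qed.

Lemma falling_opp_expansion (z : C) (n : nat) : (1 <= n)%nat ->
  (RtoC ((-1) ^ n / INR (fact n))%R * falling (- z)%C n)%C =
  sum_n_m (fun m => RtoC (Binomial.C (n - 1) (n - m) / INR (fact m))%R
                      * falling z m)%C 1 n.
Proof.
  destruct n as [|n]; [lia|intros _].
  transitivity (gbinom (z + RtoC (INR n))%C (1 + n)).
  { unfold gbinom; change (1 + n)%nat with (S n).
    rewrite <- falling_opp, RtoC_div by apply INR_fact_neq_0.
    unfold Cdiv; ring. }
  (* The offset [p = 1] makes the lower indices [1 + i] run over [1, ..., n + 1];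
     the symmetry of the row then puts the coefficients in the stated form. *)
  rewrite gbinom_vandermonde; unfold sum_n; rewrite <- sum_n_m_S.
  apply sum_n_m_ext_loc; intros i Hi.
  replace (S n - 1)%nat with n by lia; simpl (S n - S i)%nat.
  rewrite <- pascal_step1, RtoC_div by (lia || apply INR_fact_neq_0).
  unfold gbinom, Cdiv; change (1 + i)%nat with (S i).
  match goal with |- ?a = ?b => change (@eq C a b) end; ring.
Qed.

(** * Continuity of the partial integrals *)

Lemma coord_sum_shiftin (k : nat) (t : R) (v : Vector.t R k) :
  coord_sum (S k) (Vector.shiftin t v) = (coord_sum k v + t)%R.
Proof.
  unfold coord_sum; induction v as [|h k v IHv]; simpl in *; [ring|].
  rewrite IHv; ring.
Qed.

Lemma cube_RInt_ext (k : nat) (f g : Vector.t R k -> C) :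
  (forall v, f v = g v) -> cube_RInt k f = cube_RInt k g.
Proof.
  induction k as [|k IHk]; intros H; simpl; [apply H|].
  apply (RInt_ext (V := C_R_CompleteNormedModule)); intros t _; apply IHk; intros v; apply H.
Qed.

(** The codomain is [C] as a normed space over [R], the structure in which the
    cube integral is taken. *)
Definition Rcontinuous (g : R -> C) : Prop :=
  forall t : R, continuous (T := R_UniformSpace) (U := C_R_NormedModule) g t.

Lemma Rcontinuous_ex_RInt (g : R -> C) (a b : R) :
  Rcontinuous g -> ex_RInt (V := C_R_CompleteNormedModule) g a b.
Proof.
  intros H; apply (ex_RInt_continuous (V := C_R_CompleteNormedModule)).
  intros t _; apply H.
Qed.

Lemma Rcontinuous_translate (g : R -> C) (t : R) :
  Rcontinuous g -> Rcontinuous (fun s => g (s + t)%R).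
Proof.
  intros H s.
  apply (continuous_comp (fun s => s + t)%R g); [|apply H].
  apply (continuous_plus (V := R_NormedModule));
    [apply continuous_id|apply continuous_const].
Qed.

(** The average is the difference of two values of a primitive, and an
    indefinite integral is continuous. *)
Lemma Rcontinuous_moving_average (g : R -> C) : Rcontinuous g ->
  Rcontinuous
    (fun t => RInt (V := C_R_CompleteNormedModule) (fun u => g (u + t)%R) 0 1).
Proof.
  intros H.
  pose (G := fun b => RInt (V := C_R_CompleteNormedModule) g 0 b).
  assert (HG : Rcontinuous G).
  { intros t; apply (continuous_RInt_1 (V := C_R_NormedModule) g 0 t).
    apply filter_forall; intros b.
    apply (RInt_correct (V := C_R_CompleteNormedModule)).
    now apply Rcontinuous_ex_RInt. }
  intros t.
  apply continuous_ext with
    (f := fun t => minus (G := C_R_NormedModule) (G (t + 1)%R) (G t)).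
  { intros b; unfold G.
    rewrite <- (RInt_Chasles (V := C_R_CompleteNormedModule) g 0 b (b + 1))
      by now apply Rcontinuous_ex_RInt.
    transitivity (RInt (V := C_R_CompleteNormedModule) g b (b + 1)).
    { set (p := RInt (V := C_R_CompleteNormedModule) g 0 b).
      set (q := RInt (V := C_R_CompleteNormedModule) g b (b + 1)).
      change ((p + q) - p = q)%C; ring. }
    (* The affine change of variables [u |-> 1 * u + b]. *)
    replace b with (1 * 0 + b)%R at 1 by ring.
    replace (b + 1)%R with (1 * 1 + b)%R by ring.
    rewrite <- (RInt_comp_lin (V := C_R_CompleteNormedModule))
      by now apply Rcontinuous_ex_RInt.
    apply (RInt_ext (V := C_R_CompleteNormedModule)); intros u _.
    now rewrite Rmult_1_l, (scal_one (V := C_R_ModuleSpace)). }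
  apply (continuous_minus (V := C_R_NormedModule)); [|apply HG].
  now apply Rcontinuous_translate.
Qed.

(** A translation by [t] of the coordinate sum is what the outer variables
    leave behind, so this is the continuity needed to integrate over the next
    coordinate. *)
Lemma continuous_cube_RInt_shift (k : nat) (g : R -> C) : Rcontinuous g ->
  Rcontinuous (fun t => cube_RInt k (fun v => g (coord_sum k v + t)%R)).
Proof.
  intros Hg; induction k as [|k IHk].
  { intros t; apply continuous_ext with (f := g); [|apply Hg].
    intros s; unfold coord_sum; simpl; now rewrite Rplus_0_l. }
  intros t; eapply continuous_ext; [|exact (Rcontinuous_moving_average _ IHk t)].
  intros s; simpl.
  apply (RInt_ext (V := C_R_CompleteNormedModule)); intros u _; apply cube_RInt_ext; intros v.
  rewrite coord_sum_shiftin; f_equal; ring.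
Qed.

Lemma Rcontinuous_Cmult (f g : R -> C) :
  Rcontinuous f -> Rcontinuous g -> Rcontinuous (fun t => f t * g t)%C.
Proof.
  intros Hf Hg t.
  assert (Hre : forall h : R -> C, Rcontinuous h ->
            continuous (U := R_UniformSpace) (fun t => fst (h t)) t).
  { intros h Hh; apply (continuous_comp h fst); [apply Hh|].
    destruct (h t); apply continuous_fst. }
  assert (Him : forall h : R -> C, Rcontinuous h ->
            continuous (U := R_UniformSpace) (fun t => snd (h t)) t).
  { intros h Hh; apply (continuous_comp h snd); [apply Hh|].
    destruct (h t); apply continuous_snd. }
  apply (continuous_comp_2 (fun t => fst (f t * g t)%C)
           (fun t => snd (f t * g t)%C) (fun a b => (a, b))).
  - simpl; apply (continuous_minus (V := R_NormedModule));
      apply (continuous_mult (K := R_AbsRing)); auto.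
  - simpl; apply (continuous_plus (V := R_NormedModule));
      apply (continuous_mult (K := R_AbsRing)); auto.
  - apply continuous_ext with (f := fun p => p); [now intros []|].
    apply continuous_id.
Qed.

Lemma Rcontinuous_RtoC : Rcontinuous RtoC.
Proof.
  intros t; apply (continuous_comp_2 (fun t => t) (fun _ => 0%R)
                     (fun a b => (a, b))).
  - apply continuous_id.
  - apply continuous_const.
  - apply continuous_ext with (f := fun p => p); [now intros []|].
    apply continuous_id.
Qed.

Lemma Rcontinuous_falling (h : R -> C) (n : nat) :
  Rcontinuous h -> Rcontinuous (fun t => falling (h t) n).
Proof.
  intros Hh; induction n as [|n IHn]; [intros t; apply continuous_const|].
  apply Rcontinuous_Cmult; [exact IHn|].
  intros t.
  apply (continuous_minus (V := C_R_NormedModule));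
    [apply Hh|apply continuous_const].
Qed.

(** * Linearity of the cube integral *)

Lemma cube_RInt_coord_sum_S (k : nat) (g : R -> C) :
  cube_RInt (S k) (fun v => g (coord_sum (S k) v)) =
  RInt (V := C_R_CompleteNormedModule)
    (fun t => cube_RInt k (fun v => g (coord_sum k v + t)%R)) 0 1.
Proof.
  simpl; apply (RInt_ext (V := C_R_CompleteNormedModule)); intros t _; apply cube_RInt_ext; intros v.
  now rewrite coord_sum_shiftin.
Qed.

(** The induction runs over all continuous [f] and [g] at once, because
    fixing the outermost coordinate replaces them by translates. *)
Lemma cube_RInt_plus (k : nat) (f g : R -> C) :
  Rcontinuous f -> Rcontinuous g ->
  cube_RInt k (fun v => f (coord_sum k v) + g (coord_sum k v))%C =
  (cube_RInt k (fun v => f (coord_sum k v))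
    + cube_RInt k (fun v => g (coord_sum k v)))%C.
Proof.
  revert f g; induction k as [|k IHk]; intros f g Hf Hg; [reflexivity|].
  rewrite (cube_RInt_coord_sum_S k f), (cube_RInt_coord_sum_S k g),
    (cube_RInt_coord_sum_S k (fun s => f s + g s)%C).
  etransitivity.
  2:{ apply (RInt_plus (V := C_R_CompleteNormedModule));
        apply Rcontinuous_ex_RInt; now apply continuous_cube_RInt_shift. }
  apply (RInt_ext (V := C_R_CompleteNormedModule)); intros t _.
  exact (IHk _ _ (Rcontinuous_translate f t Hf) (Rcontinuous_translate g t Hg)).
Qed.

Lemma cube_RInt_scal (k : nat) (a : R) (g : R -> C) : Rcontinuous g ->
  cube_RInt k (fun v => RtoC a * g (coord_sum k v))%C =
  (RtoC a * cube_RInt k (fun v => g (coord_sum k v)))%C.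
Proof.
  revert g; induction k as [|k IHk]; intros g Hg; [reflexivity|].
  rewrite (cube_RInt_coord_sum_S k g),
    (cube_RInt_coord_sum_S k (fun s => RtoC a * g s)%C), <- scal_R_Cmult.
  etransitivity.
  2:{ apply (RInt_scal (V := C_R_CompleteNormedModule));
        apply Rcontinuous_ex_RInt; now apply continuous_cube_RInt_shift. }
  apply (RInt_ext (V := C_R_CompleteNormedModule)); intros t _; rewrite scal_R_Cmult.
  exact (IHk _ (Rcontinuous_translate g t Hg)).
Qed.

Lemma Rcontinuous_sum (a : nat -> R) (g : nat -> R -> C) (n : nat) :
  (forall m, Rcontinuous (g m)) ->
  Rcontinuous (fun t => sum_n_m (fun m => RtoC (a m) * g m t)%C 1 n).
Proof.
  intros Hg; induction n as [|n IHn]; intros t.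
  { apply continuous_ext with (f := fun _ => zero);
      [|apply continuous_const].
    intros s; rewrite sum_n_m_zero by lia; reflexivity. }
  apply continuous_ext with
    (f := fun t => plus (G := C_R_NormedModule)
             (sum_n_m (fun m => RtoC (a m) * g m t)%C 1 n)
             (RtoC (a (S n)) * g (S n) t)%C).
  { intros s; rewrite sum_n_Sm by lia; reflexivity. }
  apply (continuous_plus (V := C_R_NormedModule)); [apply IHn|].
  apply Rcontinuous_Cmult; [intros s; apply continuous_const|apply Hg].
Qed.

Lemma cube_RInt_sum (k n : nat) (a : nat -> R) (g : nat -> R -> C) :
  (forall m, Rcontinuous (g m)) ->
  cube_RInt k (fun v => sum_n_m (fun m => RtoC (a m) * g m (coord_sum k v))%C
                          1 (S n)) =
  sum_n_m (fun m => RtoC (a m) * cube_RInt k (fun v => g m (coord_sum k v)))%C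
    1 (S n).
Proof.
  intros Hg; induction n as [|n IHn].
  { rewrite sum_n_n, <- cube_RInt_scal by apply Hg.
    apply cube_RInt_ext; intros v; now rewrite sum_n_n. }
  rewrite sum_n_Sm, <- IHn, <- cube_RInt_scal by (lia || apply Hg).
  etransitivity.
  2:{ apply (cube_RInt_plus k
        (fun t => sum_n_m (fun m => RtoC (a m) * g m t)%C 1 (S n))
        (fun t => RtoC (a (S (S n))) * g (S (S n)) t)%C).
      - now apply Rcontinuous_sum.
      - apply Rcontinuous_Cmult; [intros s; apply continuous_const|apply Hg]. }
  apply cube_RInt_ext; intros v; now rewrite sum_n_Sm by lia.
Qed.

Theorem theorem2p10 :
  forall (n k : nat) (x : C), (1 <= n)%nat -> (1 <= k)%nat ->
  (RtoC ((-1) ^ n)%R * (cauchy2 k n x / RtoC (INR (fact n))))%C =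
  sum_n_m
    (fun m : nat =>
       (RtoC (Binomial.C (n - 1) (n - m)) *
        (cauchy1 k m x / RtoC (INR (fact m))))%C) 1 n.
Proof.
  intros n k x Hn _.
  assert (Hcoef : forall (a : R) (m : nat) (z : C),
    (RtoC a * (z / RtoC (INR (fact m))))%C =
    (RtoC (a / INR (fact m))%R * z)%C).
  { intros a m z; rewrite RtoC_div by apply INR_fact_neq_0.
    unfold Cdiv; ring. }
  rewrite Hcoef.
  etransitivity.
  2:{ apply sum_n_m_ext; intros m; symmetry; apply Hcoef. }
  unfold cauchy1, cauchy2.
  assert (Hsub : Rcontinuous (fun t => RtoC t - x)%C).
  { intros t; apply (continuous_minus (V := C_R_NormedModule));
      [apply Rcontinuous_RtoC|apply continuous_const]. }
  assert (Hopp : Rcontinuous (fun t => - (RtoC t - x))%C).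
  { intros t; apply (continuous_opp (V := C_R_NormedModule)), Hsub. }
  rewrite (cube_RInt_ext k _
    (fun v => falling (- (RtoC (coord_sum k v) - x))%C n))
    by (intros v; f_equal; ring).
  rewrite <- (cube_RInt_scal k _ (fun t => falling (- (RtoC t - x))%C n))
    by now apply (Rcontinuous_falling (fun t => - (RtoC t - x))%C).
  destruct n as [|n]; [lia|].
  rewrite <- (cube_RInt_sum k n _ (fun m t => falling (RtoC t - x)%C m))
    by (intros m; now apply (Rcontinuous_falling (fun t => RtoC t - x)%C)).
  apply cube_RInt_ext; intros v.
  now apply falling_opp_expansion.
Qed.
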